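(* Let $f:S\to T$ be a semiring homomorphism. Then the functor $\mathrm{Hom}_S({}_ST,-):{}_S\mathcal{M}\to{}_T\mathcal{M}$ preserves injective semimodules and preserves e-injective semimodules; that is, if $M$ is an injective (respectively, e-injective) left $S$-semimodule, then $\mathrm{Hom}_S({}_ST,M)$ is an injective (respectively, e-injective) left $T$-semimodule.
   Context: A semiring is $(S,+,\cdot,0,1)$ with $(S,+,0)$ a commutative monoid, $(S,\cdot,1)$ a monoid, multiplication distributing over addition on both sides, and $0s=0=s0$ for all $s$; semiring homomorphisms preserve $+,\cdot,0,1$. A left $S$-semimodule is a commutative monoid $(M,+,0)$ with a scalar multiplication $S\times M\to M$ satisfying $(ss')m=s(s'm)$, $s(m+m')=sm+sm'$, $(s+s')m=sm+s'm$, $1m=m$, $s0=0=0m$. Homomorphisms preserve $+$, $0$ and scalar multiplication; ${}_S\mathcal{M}$ is the category of left $S$-semimodules and $\mathcal{M}$ the category of commutative monoids. Via $f$, $T$ is a left $S$-semimodule ($s\cdot t=f(s)t$), and $\mathrm{Hom}_S({}_ST,M)$ is a left $T$-semimodule under $(th)(p)=h(pt)$ for $t,p\in T$. $M\in{}_S\mathcal{M}$ is injective if for every injective homomorphism $\mu:A\to B$ in ${}_S\mathcal{M}$ and every homomorphism $g:A\to M$ there is a homomorphism $\tilde g:B\to M$ with $\tilde g\mu=g$. A sequence $0\to A\xrightarrow{u}B\xrightarrow{v}C\to 0$ in ${}_S\mathcal{M}$ (or in $\mathcal{M}$) is short exact if $u$ is a categorical kernel of $v$ and $v$ is a categorical cokernel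 of $u$ (kernels and cokernels in the sense of categories with zero morphisms). $M\in{}_S\mathcal{M}$ is e-injective if the contravariant functor $\mathrm{Hom}_S(-,M):{}_S\mathcal{M}\to\mathcal{M}$ sends every short exact sequence $0\to A\to B\to C\to 0$ to a short exact sequence $0\to\mathrm{Hom}_S(C,M)\to\mathrm{Hom}_S(B,M)\to\mathrm{Hom}_S(A,M)\to 0$ in $\mathcal{M}$. *)

(* Defs.v *)
From HB Require Import structures.
From mathcomp Require Import all_boot all_algebra.
From mathcomp Require Import boolp.

Set Implicit Arguments.
Unset Strict Implicit.
Unset Printing Implicit Defensive.

Import GRing.Theory.
Local Open Scope ring_scope.

(* A semiring, in which [0 = 1] is allowed, is a [pzSemiRingType].  A left      *)
(* [S]-semimodule is an [lSemiModType S] and a commutative monoid an           *)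
(* [nmodType]; their morphisms are [{linear A -> B}] and [{additive A -> B}],  *)
(* which preserve [0] too.  These structures carry a choice operator on their  *)
(* carrier; in the presence of [boolp.gen_choiceMixin] this is no restriction. *)

Lemma linear_ext (S : pzSemiRingType) (A B : lSemiModType S)
    (g h : {linear A -> B}) : g =1 h -> g = h.
Proof.
case: g h => [g [[ag] [sg]]] [h [[ah] [sh]]] /= /funext gh.
rewrite gh in ag sg *.
by rewrite (Prop_irrelevance ag ah) (Prop_irrelevance sg sh).
Qed.

Section HomMonoid.
Variables (S : pzSemiRingType) (A B : lSemiModType S).

Definition hom_zero : {linear A -> B} := \0.
Definition hom_add (g h : {linear A -> B}) : {linear A -> B} := g \+ h.

Fact hom_addA : associative hom_add.
Proof. by move=> g h k; apply: linear_ext => x /=; rewrite addrA. Qed.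

Fact hom_addC : commutative hom_add.
Proof. by move=> g h; apply: linear_ext => x /=; rewrite addrC. Qed.

Fact hom_add0 : left_id hom_zero hom_add.
Proof. by move=> g; apply: linear_ext => x /=; rewrite add0r. Qed.

HB.instance Definition _ := gen_eqMixin {linear A -> B}.
HB.instance Definition _ := gen_choiceMixin {linear A -> B}.
HB.instance Definition _ :=
  GRing.isNmodule.Build {linear A -> B} hom_addA hom_addC hom_add0.

End HomMonoid.

Section HomFunctor.
Variables (S : pzSemiRingType) (A B M : lSemiModType S) (u : {linear A -> B}).

(* The contravariant functor Hom_S(-, M) on morphisms. *)
Definition hom_precomp (h : {linear B -> M}) : {linear A -> M} := h \o u.

Fact hom_precomp_is_nmod_morphism : nmod_morphism hom_precomp.
Proof. by split=> [|g h]; apply: linear_ext. Qed.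

HB.instance Definition _ := GRing.isNmodMorphism.Build
  {linear B -> M} {linear A -> M} hom_precomp hom_precomp_is_nmod_morphism.

End HomFunctor.

Arguments hom_precomp {S A B} M u h.

Section SemimoduleExactness.
Variables (S : pzSemiRingType) (A B C : lSemiModType S).
Variables (u : {linear A -> B}) (v : {linear B -> C}).

Definition is_kernel : Prop :=
  v \o u =1 \0 /\
  forall (X : lSemiModType S) (h : {linear X -> B}), v \o h =1 \0 ->
    exists! k : {linear X -> A}, u \o k =1 h.

Definition is_cokernel : Prop :=
  v \o u =1 \0 /\
  forall (X : lSemiModType S) (h : {linear B -> X}), h \o u =1 \0 ->
    exists! k : {linear C -> X}, k \o v =1 h.

Definition short_exact : Prop := is_kernel /\ is_cokernel.

End SemimoduleExactness.

Section MonoidExactness.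
Variables (A B C : nmodType) (u : {additive A -> B}) (v : {additive B -> C}).

Definition is_kernel_mon : Prop :=
  v \o u =1 \0 /\
  forall (X : nmodType) (h : {additive X -> B}), v \o h =1 \0 ->
    exists! k : {additive X -> A}, u \o k =1 h.

Definition is_cokernel_mon : Prop :=
  v \o u =1 \0 /\
  forall (X : nmodType) (h : {additive B -> X}), h \o u =1 \0 ->
    exists! k : {additive C -> X}, k \o v =1 h.

Definition short_exact_mon : Prop := is_kernel_mon /\ is_cokernel_mon.

End MonoidExactness.

Definition injective_semimodule (S : pzSemiRingType) (M : lSemiModType S) : Prop :=
  forall (A B : lSemiModType S) (mu : {linear A -> B}), injective mu ->
  forall g : {linear A -> M}, exists g' : {linear B -> M}, g' \o mu =1 g.

Definition e_injective_semimodule (S : pzSemiRingType) (M : lSemiModType S) : Prop :=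
  forall (A B C : lSemiModType S) (u : {linear A -> B}) (v : {linear B -> C}),
    short_exact u v -> short_exact_mon (hom_precomp M v) (hom_precomp M u).

Section AlongMorphism.
Variables (S T : pzSemiRingType) (f : {rmorphism S -> T}).

(* [T] seen as a left [S]-semimodule through [f]. *)
Definition along of {rmorphism S -> T} : Type := T.

HB.instance Definition _ := GRing.Nmodule.copy (along f) T.

Definition along_scale (s : S) (t : along f) : along f := f s * (t : T).

Fact along_scaleA s s' t :
  along_scale s (along_scale s' t) = along_scale (s * s') t.
Proof. by rewrite /along_scale rmorphM mulrA. Qed.

Fact along_scale0 t : along_scale 0 t = 0.
Proof. by rewrite /along_scale rmorph0 mul0r. Qed.

Fact along_scale1 : left_id 1 along_scale.
Proof. by move=> t; rewrite /along_scale rmorph1 mul1r. Qed.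

Fact along_scaleDr : right_distributive along_scale +%R.
Proof. by move=> s t t'; exact: mulrDr. Qed.

Fact along_scaleDl t : {morph along_scale^~ t : s s' / s + s'}.
Proof. by move=> s s'; rewrite /along_scale rmorphD; exact: mulrDl. Qed.

HB.instance Definition _ := GRing.Nmodule_isLSemiModule.Build S (along f)
  along_scaleA along_scale0 along_scale1 along_scaleDr along_scaleDl.

Variable M : lSemiModType S.

(* Hom_S(T, M), as a left [T]-semimodule. *)
Definition coinduced : Type := {linear along f -> M}.

HB.instance Definition _ := GRing.Nmodule.copy coinduced {linear along f -> M}.

Section Scale.
Variables (t : T) (h : {linear along f -> M}).

Definition coinduced_fun (p : along f) : M := h ((p : T) * t).

Fact coinduced_fun_is_nmod_morphism : nmod_morphism coinduced_fun.
Proof.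
split=> [|p q]; rewrite /coinduced_fun; first by rewrite mul0r; exact: raddf0.
by rewrite mulrDl; exact: raddfD.
Qed.

Fact coinduced_fun_is_scalable : scalable coinduced_fun.
Proof.
move=> s p; rewrite /coinduced_fun -linearZ; congr (h _).
exact/esym/mulrA.
Qed.

HB.instance Definition _ := GRing.isNmodMorphism.Build (along f) M
  coinduced_fun coinduced_fun_is_nmod_morphism.
HB.instance Definition _ := GRing.isScalable.Build S (along f) M *:%R
  coinduced_fun coinduced_fun_is_scalable.

End Scale.

Definition coinduced_scale (t : T) (h : coinduced) : coinduced :=
  coinduced_fun t h.

Fact coinduced_scaleA t t' h :
  coinduced_scale t (coinduced_scale t' h) = coinduced_scale (t * t') h.
Proof.
by apply: linear_ext => p /=; rewrite /coinduced_fun /= /coinduced_fun mulrA.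
Qed.

Fact coinduced_scale0 h : coinduced_scale 0 h = 0.
Proof.
by apply: linear_ext => p /=; rewrite /coinduced_fun mulr0; exact: raddf0.
Qed.

Fact coinduced_scale1 : left_id 1 coinduced_scale.
Proof. by move=> h; apply: linear_ext => p /=; rewrite /coinduced_fun mulr1. Qed.

Fact coinduced_scaleDr : right_distributive coinduced_scale +%R.
Proof. by move=> t g h; apply: linear_ext. Qed.

Fact coinduced_scaleDl h : {morph coinduced_scale^~ h : t t' / t + t'}.
Proof.
move=> t t'; apply: linear_ext => p /=; rewrite /coinduced_fun mulrDr.
exact: raddfD.
Qed.

HB.instance Definition _ := GRing.Nmodule_isLSemiModule.Build T coinduced
  coinduced_scaleA coinduced_scale0 coinduced_scale1
  coinduced_scaleDr coinduced_scaleDl.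

End AlongMorphism.

(* Main.v *)
(** Restriction of scalars along [f] is left adjoint to [Hom_S(T, -)], and the
    adjunction bijection is an isomorphism of monoids, natural in its first
    argument.  Hence it suffices that restriction preserves injective maps,
    which is clear, and short exact sequences.  It preserves cokernels because
    it is a left adjoint.  It preserves kernels because a [T]-linear map out of
    [T] is an element of its target, so that [u] is a kernel of [v] over [T] as
    soon as, and only if, [u] is a bijection onto [v^-1(0)], a condition
    independent of the scalars. *)
Require Import Defs.
From HB Require Import structures.
From mathcomp Require Import all_boot all_algebra.
From mathcomp Require Import boolp.

Set Implicit Arguments.
Unset Strict Implicit.
Unset Printing Implicit Defensive.

Import GRing.Theory.
Local Open Scope ring_scope.

(** * Transport of kernels and cokernels of monoids along isomorphisms *)

Lemma additive_ext (A B : nmodType) (g h : {additive A -> B}) : g =1 h -> g = h.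
Proof.
case: g h => [g [[ag]]] [h [[ah]]] /= /funext gh.
by rewrite gh in ag *; rewrite (Prop_irrelevance ag ah).
Qed.

Section MonoidTransport.
Variables (A B C A' B' C' : nmodType).
Variables (u : {additive A -> B}) (v : {additive B -> C}).
Variables (u' : {additive A' -> B'}) (v' : {additive B' -> C'}).
Variables (pA : {additive A' -> A}) (qA : {additive A -> A'}).
Variables (pB : {additive B' -> B}) (qB : {additive B -> B'}).
Variables (pC : {additive C' -> C}) (qC : {additive C -> C'}).
Hypotheses (pAK : cancel pA qA) (qAK : cancel qA pA).
Hypotheses (pBK : cancel pB qB) (qBK : cancel qB pB).
Hypotheses (pCK : cancel pC qC) (qCK : cancel qC pC).
Hypotheses (pu : pB \o u' =1 u \o pA) (pv : pC \o v' =1 v \o pB).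

(** Naturality of the isomorphisms [p] passes to their inverses [q]. *)
Let uq x : u' (qA x) = qB (u x).
Proof. by rewrite -[LHS]pBK; have /= -> := pu (qA x); rewrite qAK. Qed.

Let vu0 : v \o u =1 \0 -> v' \o u' =1 \0.
Proof.
move=> vu x /=; rewrite -[LHS]pCK; have /= -> := pv (u' x).
have /= -> := pu x; have /= -> := vu (pA x); exact: raddf0.
Qed.

(** A map into [B'] is carried to [B] by [pB], factored there, and brought back by [qA]; a rival
    factorization is compared after applying [pA]. *)
Lemma is_kernel_mon_transport : is_kernel_mon u v -> is_kernel_mon u' v'.
Proof.
move=> [/vu0 vu ker]; split=> // X h vh.
have [|k [uk k_uniq]] := ker X (pB \o h : {additive X -> B}).
  by move=> x /=; have /= <- := pv (h x); have /= -> := vh x; exact: raddf0.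
exists (qA \o k : {additive X -> A'}); split=> [x /=|k' uk'].
  by rewrite uq; have /= -> := uk x; rewrite pBK.
apply: additive_ext => x /=; rewrite (k_uniq (pA \o k' : {additive X -> A})) /=.
  by rewrite pAK.
by move=> y /=; have /= <- := pu (k' y); have /= -> := uk' y.
Qed.

Lemma is_cokernel_mon_transport : is_cokernel_mon u v -> is_cokernel_mon u' v'.
Proof.
move=> [/vu0 vu coker]; split=> // X h hu.
have [|k [kv k_uniq]] := coker X (h \o qB : {additive B -> X}).
  by move=> x /=; rewrite -uq; exact: hu.
exists (k \o pC : {additive C' -> X}); split=> [x /=|k' kv'].
  by have /= -> := pv x; have /= -> := kv (pB x); rewrite pBK.
apply: additive_ext => x /=.
rewrite (k_uniq (k' \o qC : {additive C -> X})) /= ?pCK // => y /=.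
rewrite -{1}(qBK y); have /= <- := pv (qB y); rewrite pCK.
exact: kv'.
Qed.

End MonoidTransport.

(** * Elements as maps out of [T], and kernels in terms of elements *)

Section LineMap.
Variables (T : pzSemiRingType) (A : lSemiModType T).

Definition line_map (a : A) (t : T^o) : A := (t : T) *: a.

Fact line_map_is_nmod_morphism a : nmod_morphism (line_map a).
Proof. by split=> [|s t]; rewrite /line_map ?scale0r ?scalerDl. Qed.

Fact line_map_is_scalable a : scalable (line_map a).
Proof. by move=> s t; rewrite /line_map scalerA. Qed.

HB.instance Definition _ a := GRing.isNmodMorphism.Build T^o A
  (line_map a) (line_map_is_nmod_morphism a).
HB.instance Definition _ a := GRing.isScalable.Build T T^o A *:%R
  (line_map a) (line_map_is_scalable a).

End LineMap.

Lemma is_kernelP (T : pzSemiRingType) (A B C : lSemiModType T)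
    (u : {linear A -> B}) (v : {linear B -> C}) :
  is_kernel u v <->
  [/\ v \o u =1 \0, injective u & forall b, v b = 0 -> exists a, u a = b].
Proof.
split=> [[vu ker]|[vu u_inj u_onto]]; split=> //.
(* The line maps of [a] and [a'] both factor [h] through [u], so they coincide; evaluation at 1
   gives back [a] and [a']. *)
- move=> a a' ua; pose h : {linear T^o -> B} := u \o line_map a.
  have [|k [_ k_uniq]] := ker T^o h; first by move=> t; exact: vu.
  have ka : k = line_map a by apply: k_uniq.
  have ka' : k = line_map a'.
    by apply: k_uniq => t /=; rewrite /line_map !linearZ /= ua.
  have := congr1 (fun g : {linear T^o -> A} => g 1) (etrans (esym ka) ka').
  by rewrite /= /line_map !scale1r.
(* Here the line map of [b] is killed by [v]; its factorization sends 1 to a preimage of [b]. *)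
- move=> b vb; have [|k [uk _]] := ker T^o (line_map b).
    by move=> t /=; rewrite /line_map linearZ /= vb scaler0.
  by exists (k 1); have /= -> := uk 1; rewrite /line_map scale1r.
- move=> X h vh.
  (* Preimages are chosen pointwise; injectivity of [u] forces the choice to be linear. *)
  have /choice[k uk] x : exists a, u a = h x by apply: u_onto; exact: vh.
  have k_nmod : nmod_morphism k.
    split=> [|x y]; apply: u_inj; first by rewrite uk !raddf0.
    by rewrite [RHS]raddfD /= !uk raddfD.
  have k_scal : scalable k.
    by move=> t x; apply: u_inj; rewrite [RHS]linearZ /= !uk linearZ.
  pose kN := GRing.isNmodMorphism.Build X A k k_nmod.
  pose kS := GRing.isScalable.Build T X A *:%R k k_scal.
  pose kL : {linear X -> A} := HB.pack k kN kS.
  exists kL; split=> [x /=|k' uk']; first exact: uk.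
  by apply: linear_ext => x /=; apply: u_inj; rewrite uk; have /= -> := uk' x.
Qed.

(** * Restriction of scalars along [f] *)

Section Restriction.
Variables (S T : pzSemiRingType) (f : {rmorphism S -> T}).

(** The morphism is recorded in the type so that the [S]-action, which depends on it, can be
    inferred from the type. *)
Definition restriction of {rmorphism S -> T} : lSemiModType T -> Type :=
  fun A => A.

Section Module.
Variable A : lSemiModType T.

HB.instance Definition _ := GRing.Nmodule.copy (restriction f A) A.

Definition restriction_scale (s : S) (a : restriction f A) : restriction f A :=
  f s *: (a : A).

Fact restriction_scaleA s s' a :
  restriction_scale s (restriction_scale s' a) = restriction_scale (s * s') a.
Proof. by rewrite /restriction_scale rmorphM scalerA. Qed.

Fact restriction_scale0 a : restriction_scale 0 a = 0.
Proof. by rewrite /restriction_scale rmorph0 scale0r. Qed.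

Fact restriction_scale1 : left_id 1 restriction_scale.
Proof. by move=> a; rewrite /restriction_scale rmorph1 scale1r. Qed.

Fact restriction_scaleDr : right_distributive restriction_scale +%R.
Proof. by move=> s a a'; exact: scalerDr. Qed.

Fact restriction_scaleDl a :
  {morph restriction_scale^~ a : s s' / s + s'}.
Proof. by move=> s s'; rewrite /restriction_scale rmorphD; exact: scalerDl. Qed.

HB.instance Definition _ := GRing.Nmodule_isLSemiModule.Build S
  (restriction f A) restriction_scaleA restriction_scale0 restriction_scale1
  restriction_scaleDr restriction_scaleDl.

End Module.

Section Map.
Variables (A B : lSemiModType T) (u : {linear A -> B}).

Definition restriction_map (a : restriction f A) : restriction f B := u a.

Fact restriction_map_is_nmod_morphism : nmod_morphism restriction_map.
Proof. by split=> [|a a']; [exact: raddf0|exact: raddfD]. Qed.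

Fact restriction_map_is_scalable : scalable restriction_map.
Proof. by move=> s a; exact: (linearZ_LR u (f s)). Qed.

HB.instance Definition _ := GRing.isNmodMorphism.Build
  (restriction f A) (restriction f B)
  restriction_map restriction_map_is_nmod_morphism.
HB.instance Definition _ := GRing.isScalable.Build S
  (restriction f A) (restriction f B) *:%R
  restriction_map restriction_map_is_scalable.

End Map.

(** * The adjunction between restriction and coinduction *)

Section Adjunction.
Variables (A : lSemiModType T) (M : lSemiModType S).

Section Curry.
Variable h : {linear restriction f A -> M}.

Section AtPoint.
Variable a : A.

Definition curry_fun (p : along f) : M := h ((p : T) *: a).

Fact curry_fun_is_nmod_morphism : nmod_morphism curry_fun.
Proof.
split=> [|p q]; rewrite /curry_fun; first by rewrite scale0r; exact: raddf0.
by rewrite scalerDl; exact: raddfD.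
Qed.

Fact curry_fun_is_scalable : scalable curry_fun.
Proof.
move=> s p; rewrite /curry_fun -linearZ; congr (h _).
exact: (esym (@scalerA T A (f s) p a)).
Qed.

HB.instance Definition _ := GRing.isNmodMorphism.Build (along f) M
  curry_fun curry_fun_is_nmod_morphism.
HB.instance Definition _ := GRing.isScalable.Build S (along f) M *:%R
  curry_fun curry_fun_is_scalable.

End AtPoint.

Definition curry (a : A) : coinduced f M := curry_fun a.

Fact curry_is_nmod_morphism : nmod_morphism curry.
Proof.
split=> [|a a']; apply: linear_ext => p /=; rewrite /curry_fun.
  by rewrite scaler0; exact: raddf0.
by rewrite scalerDr; exact: raddfD.
Qed.

(** The action on [coinduced f M] translates arguments on the right, so both sides send [p] to
    [h ((p * t) *: a)]. *)
Fact curry_is_scalable : scalable curry.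
Proof.
move=> t a; apply: linear_ext => p /=.
by rewrite /curry_fun /coinduced_fun /= /curry_fun scalerA.
Qed.

HB.instance Definition _ := GRing.isNmodMorphism.Build A (coinduced f M)
  curry curry_is_nmod_morphism.
HB.instance Definition _ := GRing.isScalable.Build T A (coinduced f M) *:%R
  curry curry_is_scalable.

End Curry.

Section Uncurry.
Variable g : {linear A -> coinduced f M}.

Definition uncurry (a : restriction f A) : M :=
  (g a : {linear along f -> M}) (1 : T).

Fact uncurry_is_nmod_morphism : nmod_morphism uncurry.
Proof. by split=> [|a a']; rewrite /uncurry ?raddf0 ?raddfD. Qed.

(** At the point 1, right translation by [f s] agrees with the action of [s] on [along f], as both
    turn 1 into [f s]. *)
Fact uncurry_is_scalable : scalable uncurry.
Proof.
move=> s a; rewrite /uncurry -linearZ.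
have -> : g (s *: a) = f s *: g a by exact: linearZ.
rewrite /= /coinduced_fun; congr ((g a : {linear along f -> M}) _).
by rewrite mul1r; exact/esym/mulr1.
Qed.

HB.instance Definition _ := GRing.isNmodMorphism.Build (restriction f A) M
  uncurry uncurry_is_nmod_morphism.
HB.instance Definition _ := GRing.isScalable.Build S (restriction f A) M *:%R
  uncurry uncurry_is_scalable.

End Uncurry.

Definition adj_curry (h : {linear restriction f A -> M}) :
  {linear A -> coinduced f M} := curry h.

Definition adj_uncurry (g : {linear A -> coinduced f M}) :
  {linear restriction f A -> M} := uncurry g.

Lemma adj_curryK : cancel adj_curry adj_uncurry.
Proof.
by move=> h; apply: linear_ext => a /=; rewrite /uncurry /= /curry_fun scale1r.
Qed.

Lemma adj_uncurryK : cancel adj_uncurry adj_curry.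
Proof.
move=> g; apply: linear_ext => a; apply: linear_ext => p /=.
(* By [T]-linearity [g (p *: a)] is [p *: g a], whose value at 1 is that of [g a] at [1 * p]. *)
rewrite /curry_fun /= /uncurry linearZ /= /coinduced_fun.
by congr ((g a : {linear along f -> M}) _); exact: mul1r.
Qed.

Fact adj_curry_is_nmod_morphism : nmod_morphism adj_curry.
Proof.
by split=> [|g h]; apply: linear_ext => a; apply: linear_ext.
Qed.

Fact adj_uncurry_is_nmod_morphism : nmod_morphism adj_uncurry.
Proof. by split=> [|g h]; apply: linear_ext. Qed.

HB.instance Definition _ := GRing.isNmodMorphism.Build
  {linear restriction f A -> M} {linear A -> coinduced f M}
  adj_curry adj_curry_is_nmod_morphism.
HB.instance Definition _ := GRing.isNmodMorphism.Build
  {linear A -> coinduced f M} {linear restriction f A -> M}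
  adj_uncurry adj_uncurry_is_nmod_morphism.

End Adjunction.

(** * Restriction preserves short exact sequences *)

Lemma restriction_is_kernel (A B C : lSemiModType T)
    (u : {linear A -> B}) (v : {linear B -> C}) :
  is_kernel u v -> is_kernel (restriction_map u) (restriction_map v).
(* Restricted maps have the same underlying functions, so the elementwise criterion carries over
   verbatim. *)
Proof. by move=> /is_kernelP[vu u_inj u_onto]; apply/is_kernelP; split. Qed.

Lemma restriction_is_cokernel (A B C : lSemiModType T)
    (u : {linear A -> B}) (v : {linear B -> C}) :
  is_cokernel u v -> is_cokernel (restriction_map u) (restriction_map v).
Proof.
move=> [vu coker]; split=> [//|X h hu].
(* The transpose of [h] is factored over [T], and the factor is transposed back. *)
have [|k [kv k_uniq]] := coker (coinduced f X) (adj_curry h).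
  move=> a; apply: linear_ext => p /=.
  by rewrite /curry_fun -linearZ; exact: hu.
exists (adj_uncurry k); split=> [b|k' kv'].
  rewrite /= /uncurry /restriction_map; have /= -> := kv b.
  by rewrite /= /curry_fun scale1r.
rewrite -[RHS]adj_curryK; congr adj_uncurry; apply: k_uniq => b.
(* By linearity of [v], the equation at [p] is [kv'] at the element [p *: b]. *)
apply: linear_ext => p /=; rewrite /curry_fun -linearZ.
exact: kv'.
Qed.

Lemma restriction_short_exact (A B C : lSemiModType T)
    (u : {linear A -> B}) (v : {linear B -> C}) :
  short_exact u v -> short_exact (restriction_map u) (restriction_map v).
Proof.
by case=> ? ?; split; [exact: restriction_is_kernel|exact: restriction_is_cokernel].
Qed.

(** * Transfer of injectivity and e-injectivity *)

Lemma coinduced_injective (M : lSemiModType S) :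
  injective_semimodule M -> injective_semimodule (coinduced f M).
Proof.
move=> injM A B mu mu_inj g.
(* The transpose of [g] is extended over [S]; the transpose of the extension then extends [g]. *)
have [g' g'mu] := injM _ _ (restriction_map mu) mu_inj (adj_uncurry g).
exists (adj_curry g') => a; apply: linear_ext => p.
rewrite -[in RHS](adj_uncurryK g) /= /curry_fun -linearZ; exact: g'mu.
Qed.

Lemma coinduced_e_injective (M : lSemiModType S) :
  e_injective_semimodule M -> e_injective_semimodule (coinduced f M).
Proof.
move=> injM A B C u v /restriction_short_exact/injM[ker coker].
(* These squares identify the Hom sequence into [coinduced f M] with that of the restricted sequence
   into [M], whose exactness is known. *)
have natural (X Y : lSemiModType T) (w : {linear X -> Y}) :
    adj_uncurry (M := M) \o hom_precomp (coinduced f M) w =1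
    hom_precomp M (restriction_map w) \o adj_uncurry (M := M).
  by move=> g; apply: linear_ext.
(* Contravariance exchanges the roles: the square of [v] comes before that of [u]. *)
split.
  exact: (is_kernel_mon_transport (@adj_uncurryK _ _) (@adj_curryK _ _)
    (@adj_uncurryK _ _) (@adj_uncurryK _ _) (natural _ _ v) (natural _ _ u) ker).
exact: (is_cokernel_mon_transport (@adj_curryK _ _)
  (@adj_uncurryK _ _) (@adj_curryK _ _)
  (@adj_uncurryK _ _) (natural _ _ v) (natural _ _ u) coker).
Qed.

End Restriction.

Theorem corollary3p5 (S T : pzSemiRingType) (f : {rmorphism S -> T}) :
  (forall M : lSemiModType S,
     injective_semimodule M -> injective_semimodule (coinduced f M)) /\
  (forall M : lSemiModType S,
     e_injective_semimodule M -> e_injective_semimodule (coinduced f M)).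
Proof.
by split=> M; [exact: coinduced_injective|exact: coinduced_e_injective].
Qed.
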